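(* For any integer $n\ge 0$, we have \[\mathrm{pod}(5n+2)\equiv 2(-1)^{n}r_{3}(8n+3) \pmod{5}.\]
   Context: For an integer $n\ge 0$, $\mathrm{pod}(n)$ denotes the number of partitions of $n$ in which the odd parts are distinct (even parts may repeat); equivalently $\sum_{n\ge 0}\mathrm{pod}(n)q^n=\prod_{i\ge 1}\frac{1+q^{2i-1}}{1-q^{2i}}$. For nonnegative integers $k,n$, $r_k(n)$ denotes the number of representations of $n$ as a sum of $k$ squares, i.e. the number of tuples $(x_1,\dots,x_k)\in\mathbb{Z}^k$ with $x_1^2+\cdots+x_k^2=n$ (order and signs count). *)

(* Defs.v *)
From mathcomp Require Import all_boot all_order all_algebra.
From mathcomp Require Import zify.

Set Implicit Arguments.
Unset Strict Implicit.
Unset Printing Implicit Defensive.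

Import GRing.Theory Num.Theory.

(* Partitions are nonincreasing sequences of positive parts. *)
Definition is_partition (n : nat) (s : seq nat) : bool :=
  [&& sorted geq s, all (leq 1) s & sumn s == n].

Definition is_pod_partition (n : nat) (s : seq nat) : bool :=
  is_partition n s && uniq [seq i <- s | odd i].

(* A partition of n has at most n parts, each at most n, so counting over
   sequences bounded in this way loses nothing: see podE below. *)
Definition pod (n : nat) : nat :=
  #|[set s : n.-bseq 'I_n.+1 | is_pod_partition n (map val s)]|.

Definition is_sum_of_squares (k n : nat) (x : k.-tuple int) : bool :=
  (\sum_(i < k) tnth x i ^+ 2 == n%:Z)%R.

(* j : 'I_(2n+1) encodes the integer j - n. *)
Definition centered (n : nat) (j : 'I_(2 * n).+1) : int := (j%:Z - n%:Z)%R.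

(* The entries of a representation of n as a sum of squares lie in
   [-n, n]: see nb_sum_of_squaresE below. *)
Definition nb_sum_of_squares (k n : nat) : nat :=
  #|[set x : k.-tuple 'I_(2 * n).+1 |
      is_sum_of_squares n (map_tuple (@centered n) x)]|.

Lemma size_le_sumn (s : seq nat) : all (leq 1) s -> size s <= sumn s.
Proof. by elim: s => //= a s IH /andP[a0 /IH]; lia. Qed.

Lemma mem_le_sumn (s : seq nat) (a : nat) : a \in s -> a <= sumn s.
Proof.
by elim: s => //= b s IH; rewrite inE => /orP[/eqP->|/IH]; lia.
Qed.

Lemma podE (n : nat) (L : seq (seq nat)) :
  uniq L -> (forall s, (s \in L) = is_pod_partition n s) -> pod n = size L.
Proof.
move=> uL HL; pose f (s : n.-bseq 'I_n.+1) : seq nat := map val s.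
have f_inj : injective f.
  by move=> s t /(inj_map val_inj) e; apply: val_inj.
rewrite /pod cardE -(size_map f); apply/perm_size/uniq_perm => //.
  by rewrite (map_inj_uniq f_inj) enum_uniq.
move=> s; rewrite HL; apply/mapP/idP => [[t]|Hs].
  by rewrite mem_enum inE => Ht ->.
have /andP[/and3P[_ s1 /eqP sn] _] := Hs.
have ssz : size (map (@inord n) s) <= n.
  by rewrite size_map -sn size_le_sumn.
have E : f (Bseq ssz) = s.
  rewrite /f /= -map_comp; apply: map_id_in => a /mem_le_sumn; rewrite sn => an /=.
  by rewrite inordK.
by exists (Bseq ssz); rewrite ?mem_enum ?inE -/(f _) E.
Qed.

Lemma nb_sum_of_squaresE (k n : nat) (L : seq (k.-tuple int)) :
  uniq L -> (forall x, (x \in L) = is_sum_of_squares n x) ->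
  nb_sum_of_squares k n = size L.
Proof.
move=> uL HL; pose f (x : k.-tuple 'I_(2 * n).+1) := map_tuple (@centered n) x.
have c_inj : injective (@centered n).
  by move=> i j /addIr [] /val_inj.
have f_inj : injective f.
  by move=> x y /(congr1 val) /(inj_map c_inj) e; apply: val_inj.
rewrite /nb_sum_of_squares cardE -(size_map f); apply/perm_size/uniq_perm => //.
  by rewrite (map_inj_uniq f_inj) enum_uniq.
move=> x; rewrite HL; apply/mapP/idP => [[t]|Hx].
  by rewrite mem_enum inE => Ht ->.
have bnd (i : 'I_k) : (- n%:Z <= tnth x i <= n%:Z)%R.
  have : (tnth x i ^+ 2 <= n%:Z)%R.
    rewrite -(eqP Hx) (bigD1 i) //= lerDl.
    by apply: sumr_ge0 => j _; apply: sqr_ge0.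
  by rewrite expr2; nia.
pose t : k.-tuple 'I_(2 * n).+1 :=
  map_tuple (fun a : int => inord (absz (a + n%:Z)%R)) x.
have E : f t = x.
  apply: eq_from_tnth => i; rewrite !tnth_map /centered inordK.
    by move: (tnth x i) (bnd i) => a /andP[]; lia.
  by move: (tnth x i) (bnd i) => a /andP[]; lia.
by exists t; rewrite ?mem_enum ?inE -/(f _) E.
Qed.

(* Main.v *)
(* Let psi = sum_(k >= 0) X^(k(k+1)/2).  Gauss's identity gives
   sum_m (-1)^m pod(m) X^m = 1 / psi, and psi^5 = psi(X^5) mod 5, so that
     psi(X^5) * sum_m (-1)^m pod(m) X^m = psi^4  (mod 5).
   Write psi = a(X^5) + X b(X^5) + X^3 c(X^5).  The terms of exponent 5i + 2 of
   psi^4 form, after X^5 |-> X,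
     6 a^2 b^2 + 12 X a b c^2 + X^2 c^4 = (a b + X c^2)^2  (mod 5),
   and a b + X c^2 = psi^2: this counts pairs of odd squares with sum 5M against
   those with sum M, i.e. it reflects the splitting 5 = (2 + i)(2 - i).  Hence
   sum_n (-1)^n pod(5n+2) X^n = psi^4 / psi = psi^3 mod 5, and the coefficient
   of X^n in psi^3 is r_3(8n+3) / 8, three squares with sum 3 mod 8 being odd.
   Power series are handled as polynomials modulo X^N. *)
Require Import Defs.
From mathcomp Require Import all_boot all_order all_algebra.
From mathcomp Require Import zify ring.

Set Implicit Arguments.
Unset Strict Implicit.
Unset Printing Implicit Defensive.

Import Order.TTheory GRing.Theory Num.Theory.
Local Open Scope ring_scope.

(** * Triangular numbers *)

Definition tri (k : nat) : nat := (k * k.+1)./2.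
Arguments tri : simpl never.

Lemma tri_double k : ((tri k).*2 = k * k.+1)%N.
Proof. by rewrite /tri even_halfK // oddM oddS; case: odd. Qed.

Lemma leq_tri k : (k <= tri k)%N.
Proof. by case: k => // k; have := tri_double k.+1; nia. Qed.

(** * Congruence of polynomials modulo X^N *)

Section Truncation.
Variable R : comNzRingType.
Implicit Types p q r : {poly R}.

Definition eqmodX N p q := take_poly N p = take_poly N q.

Lemma eqmodXP N p q :
  eqmodX N p q <-> (forall i, (i < N)%N -> p`_i = q`_i).
Proof.
split=> [h i iN|h]; last first.
  by apply/polyP => i; rewrite !coef_take_poly; case: ifP => // /h.
by have := congr1 (coefp i) h; rewrite /coefp !coef_take_poly iN.
Qed.

Lemma eqmodXW M N p q : (M <= N)%N -> eqmodX N p q -> eqmodX M p q.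
Proof.
by move=> MN /eqmodXP h; apply/eqmodXP => i iM; apply/h/(leq_trans iM).
Qed.

Lemma eqmodXM N p p' q q' :
  eqmodX N p p' -> eqmodX N q q' -> eqmodX N (p * q) (p' * q').
Proof.
move=> /eqmodXP hp /eqmodXP hq; apply/eqmodXP => i iN.
rewrite !coefM; apply: eq_bigr => j _.
by rewrite hp ?hq //; have := ltn_ord j; lia.
Qed.

Lemma eqmodXX N p q n : eqmodX N p q -> eqmodX N (p ^+ n) (q ^+ n).
Proof.
move=> h; elim: n => [|n ih]; first by rewrite !expr0.
by rewrite !exprS; apply: eqmodXM.
Qed.

Lemma eqmodXMI N p q r : p`_0 = 1 -> eqmodX N (p * q) (p * r) -> eqmodX N q r.
Proof.
move=> p0 /eqmodXP h; apply/eqmodXP; elim/ltn_ind => i ih iN.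
have := h i iN; rewrite !coefM !big_ord_recl /= p0 !mul1r subn0.
rewrite [X in _ + X](eq_bigr (fun j : 'I_i => p`_j.+1 * r`_(i - j.+1))).
  by move/addIr.
by move=> j _; rewrite ih //= /bump; have := ltn_ord j; lia.
Qed.

End Truncation.

(** * Gauss's product for the triangular series *)

Section GaussTriangular.
Variable R : comNzRingType.

Definition psi K : {poly R} := \sum_(k < K) 'X^(tri k).
(** For [s <= n] this is the quotient (X^2;X^2)_n / (X^2;X^2)_s of q-Pochhammer symbols, written as
    a product so that Shanks' sum needs no division. *)
Definition evenprod s n : {poly R} := \prod_(s <= j < n) (1 - 'X^(2 * j + 2)).
Definition oddprod n : {poly R} := \prod_(0 <= j < n) (1 - 'X^(2 * j + 1)).

(* Shanks' finite form of Gauss's identity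
   [prod (1 - X^(2j)) / (1 - X^(2j-1)) = sum X^(k(k+1)/2)], with the
   denominators cleared. *)
Lemma shanks n :
  oddprod n * psi (2 * n)
    = \sum_(0 <= s < n) evenprod s n * oddprod s * 'X^(s * (2 * n + 1)).
Proof.
elim: n => [|n ih]; first by rewrite /psi big_ord0 mulr0 big_geq.
have -> : psi (2 * n.+1)
    = psi (2 * n) + 'X^(n * (2 * n + 1)) + 'X^(n.+1 * (2 * n + 1)).
  rewrite (_ : 2 * n.+1 = (2 * n).+2)%N; last lia.
  rewrite /psi !big_ord_recr /=.
  have -> : tri (2 * n) = (n * (2 * n + 1))%N by have := tri_double (2 * n); nia.
  by have -> : tri (2 * n).+1 = (n.+1 * (2 * n + 1))%N
    by have := tri_double (2 * n).+1; nia.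
have oS s : oddprod s.+1 = oddprod s * (1 - 'X^(2 * s + 1)).
  by rewrite /oddprod big_nat_recr.
(* The sum at level [n] is extended by its term [s = n], which supplies the first of the two new
   monomials of [psi (2 * n.+1)]. *)
pose G := \sum_(0 <= s < n.+1) evenprod s n * oddprod s * 'X^(s * (2 * n + 1)).
have eG : G = oddprod n * psi (2 * n) + oddprod n * 'X^(n * (2 * n + 1)).
  by rewrite ih /G big_nat_recr //= /evenprod [X in X * _ * _]big_geq // mul1r.
pose A := evenprod ^~ n.
have AS t : (t < n)%N -> A t = (1 - 'X^(2 * t + 2)) * A t.+1.
  by move=> tn; rewrite /A /evenprod big_ltn.
have evenS t : (t <= n)%N -> evenprod t n.+1 = A t * (1 - 'X^(2 * n + 2)).
  by move=> tn; rewrite /A /evenprod big_nat_recr.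
(* Up to the factor [1 - 'X^(2 * n + 1)], partial sums at levels [n.+1] and [n] differ by a single
   boundary term; at [t = n] it supplies the second new monomial. *)
have telescope t : (t <= n)%N ->
    \sum_(0 <= s < t.+1) evenprod s n.+1 * oddprod s * 'X^(s * (2 * n.+1 + 1))
    = (1 - 'X^(2 * n + 1))
        * (\sum_(0 <= s < t.+1) A s * oddprod s * 'X^(s * (2 * n + 1)))
      + A t * oddprod t.+1 * 'X^(t.+1 * (2 * n + 1)).
  elim: t => [|t iht] tn.
    rewrite !big_nat1 oS evenS //.
    rewrite /oddprod big_geq // mul0n !mul1n expr0.
    by rewrite addn2 addn1 !exprS; ring.
  rewrite big_nat_recr //= iht; last lia.
  rewrite [in RHS]big_nat_recr //= evenS // (AS t) // (oS t.+1).
  rewrite (_ : t.+1 * (2 * n.+1 + 1) = t.+1 * (2 * n + 1) + (2 * t + 2))%N;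
    last lia.
  rewrite (_ : t.+2 * (2 * n + 1) = t.+1 * (2 * n + 1) + (2 * n + 1))%N;
    last lia.
  rewrite (_ : 2 * t.+1 + 1 = (2 * t + 2) + 1)%N; last lia.
  rewrite (_ : 2 * n + 2 = (2 * n + 1) + 1)%N; last lia.
  by rewrite !exprD expr1; ring.
rewrite telescope // -/G eG /A /evenprod [\prod_(n <= j < n) _]big_geq //.
by rewrite oS; ring.
Qed.

Lemma evenprod_coef0 s n : (evenprod s n)`_0 = 1.
Proof.
rewrite /evenprod; elim/big_rec: _ => [|j p _ p0]; first by rewrite coefC.
by rewrite coef0M p0 mulr1 coefB coefC coefXn addnC subr0.
Qed.

(** Every term of Shanks' sum with [s > 0] is divisible by X^(2n+1), so only [s = 0] survives. *)
Lemma gauss_triangular n : (0 < n)%N ->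
  eqmodX (2 * n + 1) (oddprod n * psi (2 * n)) (evenprod 0 n).
Proof.
move=> n0; apply/eqmodXP => i iN.
rewrite shanks big_ltn // mul0n expr0 mulr1 {1}/oddprod big_geq // mulr1 coefD.
rewrite [X in _ + X]coef_sum big1_seq ?addr0 // => s /andP[_].
rewrite mem_index_iota => /andP[s0 _].
by rewrite coefMXn ifT //; nia.
Qed.

End GaussTriangular.

(** * The signed generating function of pod *)

Section PodGeneratingFunction.

(* [h] is fuel; [h >= k + m] suffices. *)
Fixpoint pod_list (h k m : nat) : seq (seq nat) :=
  if h isn't h'.+1 then nseq (m == 0%N) [::] else
  if k isn't k'.+1 then nseq (m == 0%N) [::] else
  pod_list h' k' m ++
  (if (k <= m)%N
   then map (cons k) (pod_list h' (if odd k then k' else k) (m - k)) else [::]).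

Definition pod_le k m s := is_pod_partition m s && all (leq^~ k) s.

Lemma pod_le0 m s : pod_le 0 m s = (s == [::]) && (m == 0%N).
Proof.
rewrite /pod_le /is_pod_partition /is_partition.
case: s => [|a s]; first by rewrite /= !andbT eq_sym.
by case: a => [|a]; rewrite /= ?andbF.
Qed.

(** Removing the largest part [a] leaves parts at most [a]; when [a] is odd, distinctness excludes
    [a] itself, hence the bound [a.-1]. *)
Lemma pod_le_cons k m a s : pod_le k m (a :: s) =
  [&& (0 < a <= k)%N, (a <= m)%N & pod_le (if odd a then a.-1 else a) (m - a) s].
Proof.
rewrite /pod_le /is_pod_partition /is_partition /= path_sortedE; last first.
  by move=> x y z; rewrite /geq /=; lia.
have em : (a + sumn s == m) = (a <= m)%N && (sumn s == m - a)%N by lia.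
rewrite em; case: (ltnP 0 a) => //= a0; last by rewrite !andbF.
case: (leqP a m) => am; rewrite ?andbF //=.
case: (leqP a k) => ak; rewrite ?andbF //= ?andbT.
have allk : all (geq a) s -> all (leq^~ k) s.
  by move=> h; apply: sub_all h => x /=; lia.
case: ifP => oa /=; last first.
  rewrite -[all (leq^~ a) s]/(all (geq a) s).
  case: (boolP (all (geq a) s)) => [/allk ->|_]; rewrite ?andbF ?andbT //.
have -> : all (leq^~ a.-1) s = all (geq a) s && (a \notin s).
  apply/allP/andP => [h|[/allP h ns] x xs].
    split; first by apply/allP => x /h /=; lia.
    by apply/negP => /h; lia.
  have := h x xs; have : x != a by apply: contraNneq ns => <-.
  by rewrite /geq /=; lia.
rewrite mem_filter oa /=.
case: (boolP (all (geq a) s)) => [/allk ->|_]; rewrite ?andbF ?andbT //=.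
by case: (a \in s); rewrite /= ?andbF ?andbT.
Qed.

Lemma pod_leS k m s : pod_le k.+1 m s =
  pod_le k m s || (if s is a :: s' then
    [&& a == k.+1, (k < m)%N & pod_le (if odd k.+1 then k else k.+1) (m - k.+1) s']
    else false).
Proof.
case: s => [|a s]; first by rewrite orbF.
rewrite !pod_le_cons; have [->|ne] := eqVneq a k.+1.
  by rewrite ltnn leqnn.
by rewrite /= orbF; congr (_ && _); lia.
Qed.

Lemma pod_listP h k m s : (k + m <= h)%N ->
  (s \in pod_list h k m) = pod_le k m s.
Proof.
elim: h k m s => [|h ih] [|k] m s hkm.
- by rewrite pod_le0; case: m {hkm} => [|m]; rewrite /= ?inE ?andbT ?andbF.
- by move: hkm; rewrite addSn ltn0.
- by rewrite pod_le0; case: m {hkm} => [|m]; rewrite /= ?inE ?andbT ?andbF.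
rewrite /pod_list -/pod_list mem_cat ih ?pod_leS; last lia.
congr (_ || _); case: ifP => km; last by case: s => // a s; rewrite andbF.
case: s => [|a s]; first by apply/mapP => -[].
have [->|ne] := eqVneq a k.+1; last first.
  by apply/mapP => -[t _ [e]]; rewrite e eqxx in ne.
rewrite mem_map => [|x y [] //]; rewrite ih //=.
by case: ifP => _; lia.
Qed.

Lemma pod_list_uniq h k m : (k + m <= h)%N -> uniq (pod_list h k m).
Proof.
elim: h k m => [|h ih] [|k] m hkm; try by rewrite /=; case: (m == 0%N).
rewrite /pod_list -/pod_list cat_uniq ih ?andTb; last lia.
case: ifP => km //; apply/andP; split.
  apply/hasPn => _ /mapP[s _ ->]; rewrite pod_listP; last lia.
  by rewrite pod_le_cons ltnn andbF.
rewrite map_inj_uniq => [|x y [] //]; apply: ih.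
by case: ifP => _; lia.
Qed.

Definition pod_count k m := size (pod_list (k + m) k m).

Lemma size_pod_list h k m : (k + m <= h)%N ->
  size (pod_list h k m) = pod_count k m.
Proof.
move=> hkm; apply/perm_size/uniq_perm; rewrite ?pod_list_uniq //.
by move=> s; rewrite !pod_listP.
Qed.

Lemma pod_count0 m : pod_count 0 m = (m == 0%N).
Proof. by rewrite /pod_count; case: m => [|m]; rewrite /= ?size_nseq. Qed.

Lemma pod_countS k m : pod_count k.+1 m =
  (pod_count k m + (if (k < m)%N
     then pod_count (if odd k.+1 then k else k.+1) (m - k.+1) else 0))%N.
Proof.
rewrite {1}/pod_count addSn /pod_list -/pod_list size_cat size_pod_list //.
congr (_ + _)%N; case: ifP => // km; rewrite size_map size_pod_list //.
by case: ifP => _; lia.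
Qed.

Lemma pod_countT k m : (m <= k)%N -> pod_count k m = pod m.
Proof.
move=> mk; apply/esym/podE; first exact: pod_list_uniq.
move=> s; rewrite pod_listP // /pod_le; case: (boolP (is_pod_partition m s)) => //.
case/andP => /and3P[_ _ /eqP sm] _ /=; apply/allP => a /mem_le_sumn.
by rewrite sm => /leq_trans; apply.
Qed.

Variables (R : comNzRingType) (N : nat).

(** The sign substitutes -X for X, turning the factors 1 + X^(2i-1) of the pod product into 1 -
    X^(2i-1), as in Gauss's product. *)
Definition podgf k : {poly R} := \poly_(m < N) ((-1) ^+ m * (pod_count k m)%:R).

(** An odd part is taken at most once, a factor 1 + X^(k+1) before the change of sign. *)
Lemma podgf_odd k : odd k.+1 ->
  eqmodX N (podgf k.+1) ((1 - 'X^(k.+1)) * podgf k).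
Proof.
move=> ok; apply/eqmodXP => i iN; rewrite mulrBl mul1r coefB coefXnM !coef_poly iN.
rewrite pod_countS ok.
have [ik|ki] := ltnP i k.+1; first by rewrite addn0 subr0.
rewrite ifT; last lia.
rewrite natrD mulrDr -[in X in _ + X = _](subnK ki) exprD.
by rewrite -(signr_odd _ k.+1) ok expr1 addnK mulrN1 mulNr.
Qed.

(** An even part may repeat: the geometric factor 1 / (1 - X^(k+1)), with its denominator
    cleared. *)
Lemma podgf_even k : ~~ odd k.+1 ->
  eqmodX N ((1 - 'X^(k.+1)) * podgf k.+1) (podgf k).
Proof.
move=> ok; apply/eqmodXP => i iN; rewrite mulrBl mul1r coefB coefXnM !coef_poly iN.
rewrite pod_countS (negbTE ok).
have [ik|ki] := ltnP i k.+1; first by rewrite addn0 subr0.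
rewrite ifT; last lia.
rewrite natrD mulrDr -[in X in _ + X - _](subnK ki) exprD.
by rewrite -(signr_odd _ k.+1) (negbTE ok) expr0 mulr1 addnK addrK.
Qed.

Lemma podgfE n : eqmodX N (evenprod R 0 n * podgf (2 * n)) (oddprod R n).
Proof.
elim: n => [|n ih].
  rewrite /evenprod /oddprod !big_geq // mul1r; apply/eqmodXP => i iN.
  rewrite coef_poly iN pod_count0 coefC.
  by case: i {iN} => [|i]; rewrite ?expr0 ?mulr1 ?mulr0.
rewrite /evenprod /oddprod !big_nat_recr //= -/(evenprod _ _ _) -/(oddprod _ _).
rewrite (_ : 2 * n.+1 = (2 * n).+2)%N; last lia.
rewrite addn2 addn1 -mulrA.
have o1 : odd (2 * n).+1 by lia.
apply: etrans (eqmodXM erefl (podgf_even _)) _; first by lia.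
apply: etrans (eqmodXM erefl (podgf_odd o1)) _.
by rewrite mulrCA mulrC; apply: eqmodXM ih erefl.
Qed.

End PodGeneratingFunction.

(** After multiplication by the cancellable factor [evenprod R 0 n], both sides reduce to that
    factor: [podgfE] turns the left one into [oddprod R n * psi R (2 * n)], and Gauss's identity
    concludes. *)
Lemma podgf_psi (R : comNzRingType) n : (0 < n)%N ->
  eqmodX (2 * n + 1) (podgf R (2 * n + 1) (2 * n) * psi R (2 * n)) 1.
Proof.
move=> n0; apply: (eqmodXMI (evenprod_coef0 R 0 n)).
rewrite mulrA mulr1.
apply: etrans (eqmodXM (podgfE _ _ _) erefl) _.
exact: gauss_triangular.
Qed.

(** * Pairs of odd squares and the Gaussian integers *)

Section OddLattice.

Lemma count_bij (T1 T2 : eqType) (s1 : seq T1) (s2 : seq T2)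
    (P1 : pred T1) (P2 : pred T2) (f : T1 -> T2) (g : T2 -> T1) :
  uniq s1 -> uniq s2 ->
  {in s1, forall x, P1 x -> [/\ f x \in s2, P2 (f x) & g (f x) = x]} ->
  {in s2, forall y, P2 y -> [/\ g y \in s1, P1 (g y) & f (g y) = y]} ->
  count P1 s1 = count P2 s2.
Proof.
move=> u1 u2 hf hg; rewrite -!size_filter -(size_map f).
apply/perm_size/uniq_perm; last 1 first.
- move=> y; rewrite mem_filter; apply/mapP/andP => [[x]|[Py ys]].
    by rewrite mem_filter => /andP[Px xs] ->; case: (hf x xs Px).
  by have [gs Pg e] := hg y ys Py; exists (g y); rewrite ?mem_filter ?Pg.
- rewrite map_inj_in_uniq ?filter_uniq // => x y.
  rewrite !mem_filter => /andP[Px xs] /andP[Py ys] e.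
  by have [_ _ <-] := hf x xs Px; have [_ _ <-] := hf y ys Py; rewrite e.
exact: filter_uniq.
Qed.

(** The window matches the index range of [psi K] through (2k+1)^2 = 8 [tri k] + 1, each square
    occurring with both signs. *)
Definition odd_ints K : seq int :=
  [seq (2 * k + 1)%:Z | k <- iota 0 K] ++ [seq - (2 * k + 1)%:Z | k <- iota 0 K].

Lemma mem_odd_ints K x : (x \in odd_ints K) = odd `|x| && (`|x| < 2 * K)%N.
Proof.
rewrite mem_cat; apply/orP/andP => [[] /mapP[k]|[ox xK]].
- by rewrite mem_iota => kK ->; lia.
- by rewrite mem_iota => kK ->; lia.
have [x0|x0] := leP 0 x; [left|right]; apply/mapP; exists (`|x|./2)%N.
all: rewrite ?mem_iota; lia.
Qed.

Lemma odd_ints_uniq K : uniq (odd_ints K).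
Proof.
rewrite cat_uniq !map_inj_uniq ?iota_uniq ?andbT /=; try by move=> a b; lia.
by apply/hasPn => x /mapP[k _ ->]; apply/mapP => -[l _]; lia.
Qed.

Definition odd_box K := [seq (x, y) | x <- odd_ints K, y <- odd_ints K].

Lemma mem_odd_box K x y :
  ((x, y) \in odd_box K) = (x \in odd_ints K) && (y \in odd_ints K).
Proof.
apply/allpairsP/andP => [[[a b] [/= ? ? [-> ->]]]|[? ?]] //.
by exists (x, y).
Qed.

Lemma odd_box_uniq K : uniq (odd_box K).
Proof. by rewrite allpairs_uniq ?odd_ints_uniq // => -[? ?] [? ?]. Qed.

Lemma sum_odd_ints K (F : int -> nat) : (forall x, F (- x) = F x) ->
  (\sum_(x <- odd_ints K) F x = 2 * \sum_(k < K) F (2 * k + 1)%:Z)%N.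
Proof.
move=> hF; rewrite big_cat !big_map /= (eq_bigr _ (fun k _ => hF _)).
by rewrite -(big_mkord xpredT (fun k => F (2 * k + 1)%:Z)) /index_iota subn0; lia.
Qed.

Lemma count_odd_box K (P : pred (int * int)) :
  (forall x y, P (- x, y) = P (x, y)) -> (forall x y, P (x, - y) = P (x, y)) ->
  count P (odd_box K)
    = (4 * \sum_(k < K) \sum_(l < K) P ((2 * k + 1)%:Z, (2 * l + 1)%:Z))%N.
Proof.
move=> h1 h2; rewrite -sum1_count big_mkcond big_allpairs.
rewrite (eq_bigr (fun x =>
  2 * \sum_(l < K) P (x, (2 * l + 1)%:Z)))%N => [|x _]; last first.
  rewrite -(sum_odd_ints _ (F := fun y => P (x, y))) => [|y]; last by rewrite h2.
  by apply: eq_bigr => y _; case: (P _).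
rewrite (sum_odd_ints _ (F := fun x =>
  (2 * \sum_(l < K) P (x, (2 * l + 1)%:Z))%N)) => [|x].
  by rewrite -big_distrr /=; lia.
by congr (_ * _)%N; apply: eq_bigr => l _; rewrite h1.
Qed.

Definition norm_is (M : nat) (p : int * int) : bool :=
  p.1 ^+ 2 + p.2 ^+ 2 == M%:Z.

(* Multiplication by 2 + i identifies the Gaussian integers x + iy of norm M
   with those of norm 5M in the ideal (2 + i), i.e. with y = 3x mod 5; following
   it by conjugation reaches the ideal (2 - i), i.e. y = 2x mod 5. *)
Lemma count_norm5 K m (e : bool) : (5 * m + 1 < K)%N ->
  count [pred p | norm_is (8 * (5 * m + 1) + 2) p
                  & (5 %| p.2 - (if e then 2 else 3) * p.1)%Z] (odd_box K)
  = count (norm_is (8 * m + 2)) (odd_box K).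
Proof.
(* [s = -1] encodes the conjugation that exchanges the ideals (2 + i) and (2 - i). *)
move=> mK; pose s : int := if e then -1 else 1.
have bound x y M : (M < K)%N -> x ^+ 2 + y ^+ 2 = (8 * M + 2)%:Z ->
    odd `|x| -> odd `|y| -> (x, y) \in odd_box K.
  move=> MK h ox oy; rewrite mem_odd_box !mem_odd_ints ox oy /=.
  by apply/andP; split; nia.
apply: (@count_bij _ _ _ _ _ _
  (* Division by 2 + i, after conjugation if [s = -1]: multiply by 2 - i and divide by 5. *)
  (fun p => ((2 * p.1 + s * p.2) %/ 5, (2 * s * p.2 - p.1) %/ 5)%Z)
  (fun p => (2 * p.1 - p.2, s * (p.1 + 2 * p.2)))); rewrite ?odd_box_uniq //.
- case=> x y; rewrite mem_odd_box !mem_odd_ints => /andP[/andP[ox _] /andP[oy _]].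
  case/andP => /= /eqP /= hn hd.
  pose u := ((2 * x + s * y) %/ 5)%Z; pose v := ((2 * s * y - x) %/ 5)%Z.
  have [ex ey] : x = 2 * u - v /\ y = s * (u + 2 * v).
    by rewrite /u /v /s; move: hd; case: (e); lia.
  have [ou ov] : odd `|u| /\ odd `|v|.
    clear hn hd bound; move: u v ex ey => u v ex ey.
    by move: ox oy; rewrite ex ey /s; case: (e); lia.
  have huv : u ^+ 2 + v ^+ 2 = (8 * m + 2)%:Z.
    have e5 : (2 * u - v) ^+ 2 + (s * (u + 2 * v)) ^+ 2 = 5 * (u ^+ 2 + v ^+ 2).
      by rewrite /s; case: (e); ring.
    by move: hn; rewrite ex ey e5; move: (u ^+ 2 + v ^+ 2) => w; clear; lia.
  rewrite /norm_is /= -/u -/v huv eqxx -ex -ey; split=> //.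
  by apply: (bound _ _ m) => //; clear -mK; lia.
- case=> x y; rewrite mem_odd_box !mem_odd_ints => /andP[/andP[ox _] /andP[oy _]].
  move=> /eqP /= hn.
  have hn' : (2 * x - y) ^+ 2 + (s * (x + 2 * y)) ^+ 2
      = (8 * (5 * m + 1) + 2)%:Z.
    by rewrite /s; case: (e); move: hn; rewrite !expr2; nia.
  clear hn; split; first apply: (bound _ _ (5 * m + 1)%N) => //.
  - by clear hn'; lia.
  - by clear hn'; rewrite /s; case: (e); lia.
  - by rewrite /norm_is /= hn' eqxx /=; clear hn'; rewrite /s; case: (e); lia.
  by clear hn'; rewrite /s; congr (_, _); case: (e); lia.
Qed.

(** Residues 2 and 4 never occur, which leaves [psi] only three sections modulo 5; residue 3 occurs
    exactly when k = 2 mod 5, that is, when 5 divides 2k + 1. *)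
Lemma tri_mod5 k : (tri k %% 5 = nth 0 [:: 0; 1; 3; 1; 0] (k %% 5))%N.
Proof.
pose a := (k %/ 5)%N; pose r := (k %% 5)%N.
have : (k * k.+1 = 5 * (5 * a ^ 2 + 2 * a * r + a) + r * r.+1)%N.
  by rewrite (divn_eq k 5) -/a -/r; ring.
rewrite -tri_double -/r; move: (5 * a ^ 2 + _ + _)%N => q.
have : (r < 5)%N by rewrite ltn_mod.
by move: r => [|[|[|[|[|r]]]]] //= _; lia.
Qed.

Lemma mod5_tri k : (5 %| (2 * k + 1)%:Z)%Z = (tri k %% 5 == 3)%N.
Proof.
have -> : (5 %| (2 * k + 1)%:Z)%Z = (k %% 5 == 2%N)%N by lia.
rewrite tri_mod5; have : (k %% 5 < 5)%N by rewrite ltn_mod.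
by case: (k %% 5)%N => [|[|[|[|[|r]]]]].
Qed.

(* Inclusion-exclusion: an element of norm 5M lies in (2 + i) or in (2 - i), and
   in both exactly when 5 divides it. *)
Lemma pairs_tri K m : (5 * m + 1 < K)%N ->
  (\sum_(k < K) \sum_(l < K) (tri k + tri l == 5 * m + 1)
   + \sum_(k < K) \sum_(l < K)
       [&& tri k %% 5 == 3, tri l %% 5 == 3 & tri k + tri l == 5 * m + 1]
   = 2 * \sum_(k < K) \sum_(l < K) (tri k + tri l == m))%N.
Proof.
move=> mK; pose W := (8 * (5 * m + 1) + 2)%N.
have norm_tri k l M : norm_is (8 * M + 2) ((2 * k + 1)%:Z, (2 * l + 1)%:Z)
    = (tri k + tri l == M)%N.
  by rewrite /norm_is /=; have := tri_double k; have := tri_double l; nia.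
have normN M x y : (norm_is M (- x, y) = norm_is M (x, y))
    * (norm_is M (x, - y) = norm_is M (x, y)) by rewrite /norm_is /= !sqrrN.
pose I : pred (int * int) := [pred p | [&& norm_is W p, 5 %| p.1 & 5 %| p.2]%Z].
have cI : count I (odd_box K) = (4 * \sum_(k < K) \sum_(l < K)
    [&& tri k %% 5 == 3, tri l %% 5 == 3 & tri k + tri l == 5 * m + 1])%N.
  rewrite count_odd_box => [|x y|x y]; rewrite /I /= ?normN ?dvdzE ?abszN //.
  congr (_ * _)%N; apply: eq_bigr => k _; apply: eq_bigr => l _.
  by rewrite norm_tri !mod5_tri andbC andbA.
have cn M : count (norm_is (8 * M + 2)) (odd_box K)
    = (4 * \sum_(k < K) \sum_(l < K) (tri k + tri l == M))%N.
  rewrite (count_odd_box _ (fun x y => (normN _ x y).1)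
    (fun x y => (normN _ x y).2)).
  by congr (_ * _)%N; apply: eq_bigr => k _; apply: eq_bigr => l _; rewrite norm_tri.
have := count_predUI
  [pred p | norm_is W p & (5 %| p.2 - 2 * p.1)%Z]
  [pred p | norm_is W p & (5 %| p.2 - 3 * p.1)%Z] (odd_box K).
rewrite (count_norm5 true) // (count_norm5 false) //.
rewrite (eq_count (a1 := predU _ _) (a2 := norm_is W)) => [|[x y]]; last first.
  rewrite /= -andb_orr; case: (boolP (norm_is W (x, y))) => //= /eqP /= hn.
  rewrite !dvdzE -Euclid_dvdM // -abszM -dvdzE.
  (* The norm form splits modulo 5 and 5 divides [W], so the prime 5 divides one of the two
     factors. *)
  have -> : (y - 2 * x) * (y - 3 * x) = (W%:Z + 5 * (x ^+ 2 - x * y)).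
    by rewrite -hn; ring.
  by rewrite /W; lia.
(* The two linear forms differ by [x]; if 5 divides both, it divides [x] and then [y]. *)
rewrite (eq_count (a1 := predI _ _) (a2 := I)) => [|[x y]]; last first.
  rewrite /I /=; case: (norm_is W (x, y)) => //=; lia.
by rewrite cI !cn; lia.
Qed.

End OddLattice.

(** * Sections of a polynomial along residue classes of exponents *)

Section Multisection.
Variable R : comNzRingType.
Implicit Types p q : {poly R}.

(** The bound [size p] loses nothing for positive [d], since then [d * i + r >= i]. *)
Definition msect d r p : {poly R} := \poly_(i < size p) p`_(d * i + r).

Lemma coef_msect d r p i : (0 < d)%N -> (msect d r p)`_i = p`_(d * i + r).
Proof.
move=> d0; rewrite coef_poly; case: ltnP => // pi.
by rewrite nth_default //; apply: leq_trans pi _; nia.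
Qed.

Lemma msect_sum d r n (F : nat -> {poly R}) : (0 < d)%N ->
  msect d r (\sum_(s < n) F s) = \sum_(s < n) msect d r (F s).
Proof.
move=> d0; apply/polyP => i; rewrite coef_msect // !coef_sum.
by apply: eq_bigr => s _; rewrite coef_msect.
Qed.

Lemma msectXnM d r s p : (r < d)%N -> (s < d)%N ->
  msect d r ('X^s * (p \Po 'X^d)) = if r == s then p else 0.
Proof.
move=> rd sd; have d0 : (0 < d)%N by lia.
apply/polyP => i; rewrite coef_msect // coefXnM coef_comp_poly_Xn //.
have [->|rs] := eqVneq r s.
  by rewrite ltnNge leq_addl /= addnK dvdn_mulr // mulKn.
rewrite coef0; case: ltnP => // si; case: ifP => // /dvdnP[c hc].
have e : (i * d + r = c * d + s)%N by lia.
by move: rs; have := congr1 (modn^~ d) e; rewrite !modnMDl !modn_small // => ->;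
  rewrite eqxx.
Qed.

Lemma eqmodX_msect d r N p q : (r < d)%N -> eqmodX (d * N) p q ->
  eqmodX N (msect d r p) (msect d r q).
Proof.
move=> rd /eqmodXP h; apply/eqmodXP => i iN.
by rewrite !coef_msect; try lia; apply: h; nia.
Qed.

Lemma msect_split d p : (0 < d)%N ->
  p = \sum_(r < d) 'X^r * (msect d r p \Po 'X^d).
Proof.
move=> d0; apply/polyP => i; rewrite coef_sum.
have id : (i %% d < d)%N by rewrite ltn_mod.
have im : (i = d * (i %/ d) + i %% d)%N by rewrite mulnC -divn_eq.
rewrite (bigD1 (Ordinal id)) //= big1 => [|r].
  rewrite addr0 coefXnM coef_comp_poly_Xn // coef_msect // ltnNge leq_mod /=.
  have -> : (i - i %% d = d * (i %/ d))%N by rewrite {1}im addnK.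
  by rewrite dvdn_mulr // mulKn // -im.
rewrite -val_eqE /= => ri; rewrite coefXnM coef_comp_poly_Xn //.
case: ltnP => // ri'; case: ifP => // /dvdnP[c hc].
have e : i = (c * d + r)%N by lia.
by move: ri; rewrite e modnMDl modn_small ?eqxx.
Qed.

Lemma msect_sumXnM d r (F : nat -> {poly R}) : (r < d)%N ->
  msect d r (\sum_(s < d) 'X^s * (F s \Po 'X^d)) = F r.
Proof.
move=> rd; rewrite (msect_sum _ _ (fun s => 'X^s * (F s \Po 'X^d))); last lia.
rewrite (bigD1 (Ordinal rd)) //= msectXnM // eqxx big1 ?addr0 // => s.
by rewrite -val_eqE /= msectXnM // eq_sym => /negbTE ->.
Qed.

(** Multiplying by a polynomial in X^d moves exponents only within their residue class modulo
    [d]. *)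
Lemma msectM_comp d r p q : (r < d)%N ->
  msect d r (p * (q \Po 'X^d)) = msect d r p * q.
Proof.
move=> rd; rewrite [in LHS](@msect_split d p); last lia.
rewrite mulr_suml -[RHS](msect_sumXnM (fun s => msect d s p * q) rd).
by congr msect; apply: eq_bigr => s _; rewrite comp_polyM mulrA.
Qed.

(** Reads the sections off a guessed decomposition, whose correctness is left to [ring]. *)
Lemma msect5_expand (t0 t1 t2 t3 t4 p : {poly R}) :
  p = (t0 \Po 'X^5) + 'X * (t1 \Po 'X^5) + 'X^2 * (t2 \Po 'X^5)
      + 'X^3 * (t3 \Po 'X^5) + 'X^4 * (t4 \Po 'X^5) ->
  [/\ msect 5 0 p = t0, msect 5 1 p = t1, msect 5 2 p = t2, msect 5 3 p = t3
    & msect 5 4 p = t4].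
Proof.
pose F := nth 0 [:: t0; t1; t2; t3; t4].
have -> : (t0 \Po 'X^5) + 'X * (t1 \Po 'X^5) + 'X^2 * (t2 \Po 'X^5)
      + 'X^3 * (t3 \Po 'X^5) + 'X^4 * (t4 \Po 'X^5)
      = \sum_(s < 5) 'X^s * (F s \Po 'X^5).
  by rewrite !big_ord_recl big_ord0 /= expr0 expr1 mul1r addr0 !addrA.
by move=> ->; rewrite !msect_sumXnM.
Qed.

End Multisection.

(** * Sections modulo 5 of the triangular series and its powers *)

Section Psi5.
Variable R : comNzRingType.
Implicit Types N K : nat.

Local Notation psi := (psi R).

Lemma coef_psi K m : (psi K)`_m = (\sum_(k < K) (tri k == m))%:R.
Proof.
rewrite coef_sum natr_sum; apply: eq_bigr => k _.
by rewrite coefXn eq_sym.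
Qed.

Lemma msect_psi0 K r : (r == 2)%N || (r == 4)%N -> msect 5 r (psi K) = 0.
Proof.
move=> hr; apply/polyP => m; rewrite coef_msect // coef_psi coef0 big1 // => k _.
have [e|//] := eqVneq (tri k) (5 * m + r)%N.
have := tri_mod5 k; rewrite e mulnC modnMDl; have := ltn_pmod k (isT : 0 < 5)%N.
by case/orP: hr => /eqP ->; case: (k %% 5)%N => [|[|[|[|[|]]]]].
Qed.

Lemma psi_split K : psi K = (msect 5 0 (psi K) \Po 'X^5)
  + 'X * (msect 5 1 (psi K) \Po 'X^5) + 'X^3 * (msect 5 3 (psi K) \Po 'X^5).
Proof.
rewrite [LHS](@msect_split _ 5) // !big_ord_recl big_ord0 /= /bump /=.
rewrite (@msect_psi0 K 2) // (@msect_psi0 K 4) // !comp_poly0.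
by rewrite !mulr0 !addr0 add0r expr0 expr1 mul1r addrA.
Qed.

Lemma msect_psi2 K (a := msect 5 0 (psi K)) (b := msect 5 1 (psi K))
    (c := msect 5 3 (psi K)) :
  msect 5 1 (psi K ^+ 2) = 2%:R * a * b + 'X * c ^+ 2.
Proof.
have [] // := @msect5_expand _ (a ^+ 2)
  (2%:R * a * b + 'X * c ^+ 2) (b ^+ 2) (2%:R * a * c) (2%:R * b * c) (psi K ^+ 2).
rewrite psi_split -/a -/b -/c.
(* The extra equation handles carries such as X^3 * X^3 = X * X^5, where X^5 is ['X \Po 'X^5]. *)
by ring: (comp_polyX ('X^5 : {poly R})).
Qed.

Lemma msect_psi4 K (a := msect 5 0 (psi K)) (b := msect 5 1 (psi K))
    (c := msect 5 3 (psi K)) :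
  msect 5 2 (psi K ^+ 4)
    = 6%:R * a ^+ 2 * b ^+ 2 + 12%:R * 'X * a * b * c ^+ 2 + 'X^2 * c ^+ 4.
Proof.
(* [s0] to [s4] are the sections of psi^2; squaring their combination yields those of psi^4. *)
pose s0 := a ^+ 2.
pose s1 := 2%:R * a * b + 'X * c ^+ 2.
pose s2 := b ^+ 2. pose s3 := 2%:R * a * c. pose s4 := 2%:R * b * c.
have [] // := @msect5_expand _ (s0 ^+ 2 + 2%:R * 'X * (s1 * s4 + s2 * s3))
  (2%:R * s0 * s1 + 'X * (2%:R * s2 * s4 + s3 ^+ 2))
  (6%:R * a ^+ 2 * b ^+ 2 + 12%:R * 'X * a * b * c ^+ 2 + 'X^2 * c ^+ 4)
  (2%:R * s0 * s3 + 2%:R * s1 * s2 + 'X * s4 ^+ 2)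
  (2%:R * s0 * s4 + 2%:R * s1 * s3 + s2 ^+ 2) (psi K ^+ 4).
rewrite /s0 /s1 /s2 /s3 /s4 psi_split -/a -/b -/c.
by ring: (comp_polyX ('X^5 : {poly R})).
Qed.

End Psi5.

(** * Theta series and sums of three squares *)

Section SumsOfSquares.
Variable R : comNzRingType.

(** The window |j| <= N is the one of [nb_sum_of_squares], so the terms of a power of [theta N]
    correspond to the tuples counted there. *)
Definition theta N : {poly R} := \sum_(j < (2 * N).+1) 'X^(`|centered j| ^ 2).

Lemma coef_theta_exp k N : (theta N ^+ k)`_N = (nb_sum_of_squares k N)%:R.
Proof.
pose h (t : k.-tuple 'I_(2 * N).+1) := [ffun i => tnth t i].
have h_bij : bijective h.
  exists (fun f : {ffun 'I_k -> 'I_(2 * N).+1} => [tuple f i | i < k]).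
    by move=> t; apply: eq_from_tnth => i; rewrite tnth_mktuple ffunE.
  by move=> f; apply/ffunP => i; rewrite ffunE tnth_mktuple.
have -> : theta N ^+ k = \prod_(i < k) theta N by rewrite prodr_const card_ord.
rewrite bigA_distr_bigA coef_sum (reindex h); last exact: onW_bij.
rewrite /nb_sum_of_squares cardsE -sum1_card natr_sum [RHS]big_mkcond.
apply: eq_bigr => t _; rewrite -expr_sum coefXn.
rewrite -[t \in _]/(is_sum_of_squares N (map_tuple (@centered N) t)).
rewrite /is_sum_of_squares.
set s := (\sum_(i < k) _)%N; set z := \sum_(i < k) _.
have -> : z = s%:Z.
  rewrite /z /s (big_morph Posz PoszD (erefl _)); apply: eq_bigr => i _.
  by rewrite tnth_map ffunE expr2; nia.
by rewrite eqz_nat eq_sym; case: (_ == _).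
Qed.

Lemma sum_centered N (F : nat -> {poly R}) :
  \sum_(j < (2 * N).+1) F `|centered j|%N = F 0%N + 2%:R * \sum_(i < N) F i.+1.
Proof.
have e M : \sum_(j < (2 * M).+1) F `|centered j|%N
    = \sum_(j < (2 * M).+1) F `|j%:Z - M%:Z|%N by [].
rewrite e; elim: N {e} => [|N ih].
  by rewrite big_ord_recl !big_ord0 /= mulr0.
rewrite (_ : 2 * N.+1 = (2 * N).+2)%N; last lia.
rewrite big_ord_recl big_ord_recr /= [in RHS]big_ord_recr /= mulrDr.
rewrite [in RHS]addrA -ih.
rewrite subn0.
have -> : `|(bump 0 (2 * N).+1)%:Z - N.+1%:Z|%N = N.+1 by rewrite /bump; lia.
rewrite (eq_bigr (fun j : 'I_(2 * N).+1 => F `|j%:Z - N%:Z|%N)); first by ring.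
by move=> j _; congr F; rewrite /bump; lia.
Qed.

Lemma sum_parity K (F : nat -> {poly R}) :
  \sum_(i < 2 * K + 1) F i.+1
    = \sum_(k < K) F (2 * k.+1)%N + \sum_(k < K.+1) F (2 * k + 1)%N.
Proof.
elim: K => [|K ih]; first by rewrite big_ord0 !big_ord_recl !big_ord0 add0r.
rewrite (_ : 2 * K.+1 + 1 = (2 * K + 1).+2)%N; last lia.
rewrite 2!big_ord_recr /= ih [X in _ = X + _]big_ord_recr
  [X in _ = _ + X]big_ord_recr /=.
rewrite (_ : (2 * K + 1).+1 = 2 * K.+1)%N; last lia.
by rewrite (_ : (2 * K.+1).+1 = 2 * K.+1 + 1)%N; [ring|lia].
Qed.

(** Even squares have exponent 0 mod 4, and odd ones give 2 X psi(X^8). Writing X^8 as (X^4)^2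
    prepares a section modulo 4. *)
Lemma theta_split K : exists q, theta (2 * K + 1)
  = (q \Po 'X^4) + 'X * (2%:R * (psi R K.+1 \Po 'X^2) \Po 'X^4).
Proof.
exists (1 + 2%:R * \sum_(k < K) 'X^(k.+1 ^ 2)).
rewrite /theta (sum_centered _ (fun i => 'X^(i ^ 2))).
rewrite (sum_parity K (fun i => 'X^(i ^ 2))).
rewrite comp_polyD !comp_polyM comp_polyC !rmorph_nat expr0 mulrDr addrA /psi.
rewrite -comp_polyA comp_Xn_poly -exprM !raddf_sum !mulr_sumr /=.
congr (_ + _ + _).
  apply: eq_bigr => k _; congr (_ * _).
  by rewrite comp_Xn_poly -exprM; congr ('X^_); lia.
apply: eq_bigr => k _; rewrite mulrCA comp_Xn_poly -exprM -exprS.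
by congr (_ * 'X^_); have := tri_double k; nia.
Qed.

(** As [tri k >= k], the terms of index at least [N] vanish modulo X^N. *)
Lemma psi_eqmodX N K K' : (N <= K)%N -> (N <= K')%N ->
  eqmodX N (psi R K) (psi R K').
Proof.
have h L : (N <= L)%N -> eqmodX N (psi R L) (psi R N).
  move=> NL; apply/eqmodXP => i iN; rewrite /psi -(subnKC NL) big_split_ord /=.
  rewrite coefD [X in _ + X](_ : _ = 0) ?addr0 // coef_sum big1 // => k _.
  have := leq_trans (leq_addr k N) (leq_tri (N + k)).
  by rewrite coefXn; case: eqP => //; lia.
by move=> /h hK /h hK'; rewrite /eqmodX hK hK'.
Qed.

Lemma sum_three_squares n K : (n < K)%N ->
  (nb_sum_of_squares 3 (8 * n + 3))%:R = 8%:R * (psi R K ^+ 3)`_n.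
Proof.
move=> nK; rewrite -coef_theta_exp.
have [q] := theta_split (4 * n + 1); set w := psi R _ \Po 'X^2.
rewrite (_ : 2 * (4 * n + 1) + 1 = 8 * n + 3)%N; last lia.
(* Sections modulo 4 of the cube, by the number of odd squares; exponent 3 mod 4 requires all three
   odd, and 2^3 gives the factor 8. *)
move=> ->; pose F := nth 0 [:: q ^+ 3; 6%:R * q ^+ 2 * w; 12%:R * q * w ^+ 2;
  8%:R * w ^+ 3].
have -> : (8 * n + 3 = 4 * (2 * n) + 3)%N by lia.
rewrite -coef_msect //.
have -> : ((q \Po 'X^4) + 'X * (2%:R * w \Po 'X^4)) ^+ 3
    = \sum_(r < 4) 'X^r * (F r \Po 'X^4).
  by rewrite !big_ord_recl big_ord0 /F /=; ring.
rewrite msect_sumXnM //.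
have -> : F 3%N = (8%:R * psi R (4 * n + 1).+1 ^+ 3) \Po 'X^2.
  by rewrite /F /w /=; ring.
rewrite coef_comp_poly_Xn // dvdn_mulr // mulKn // !mulr_natl coefMn; congr (_ *+ _).
suff /eqmodXP h : eqmodX n.+1 (psi R (4 * n + 1).+1 ^+ 3) (psi R K ^+ 3) by apply: h.
by apply/eqmodXX/psi_eqmodX; lia.
Qed.

End SumsOfSquares.

(** * The fourth power modulo 5 and the congruence *)

(** This is [pairs_tri] read coefficientwise: the term with [msect 5 3] counts the pairs whose
    triangular numbers are both 3 mod 5. *)
Lemma eqmodX_sqr_psi (R : comNzRingType) N K : (5 * N <= K)%N ->
  eqmodX N (msect 5 1 (psi R K ^+ 2) + 'X * msect 5 3 (psi R K) ^+ 2)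
    (2%:R * psi R K ^+ 2).
Proof.
move=> NK; apply/eqmodXP => m mN.
pose c3 k := (tri k %% 5 == 3)%N.
have coef2 (P : pred nat) i : ((\sum_(k < K | P k) 'X^(tri k) : {poly R}) ^+ 2)`_i
    = (\sum_(k < K) \sum_(l < K) [&& P k, P l & tri k + tri l == i]%N)%:R.
  rewrite expr2 big_distrlr coef_sum natr_sum big_mkcond; apply: eq_bigr => k _.
  case: (P k); last by rewrite /= big1.
  rewrite coef_sum natr_sum big_mkcond; apply: eq_bigr => l _.
  by case: (P l); rewrite //= -exprD coefXn eq_sym.
have psiT : psi R K = \sum_(k < K | predT (k : nat)) 'X^(tri k) by [].
have psi3 : 'X^3 * (msect 5 3 (psi R K) \Po 'X^5)
    = \sum_(k < K | c3 k) 'X^(tri k).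
  apply/polyP => i; rewrite coefXnM coef_comp_poly_Xn // coef_msect //.
  rewrite !coef_sum [RHS]big_mkcond /c3.
  have [i3|i3] := eqVneq (i %% 5)%N 3%N.
    rewrite ltnNge (_ : (3 <= i)%N = true); last lia.
    rewrite (_ : (5 %| i - 3)%N = true); last lia.
    rewrite (_ : (5 * ((i - 3) %/ 5) + 3 = i)%N); last lia.
    apply: eq_bigr => k _; case: eqP => // k3.
    by rewrite coefXn; case: eqP => // ik; move: i3; rewrite ik => /k3.
  rewrite [RHS]big1 => [|k _]; last first.
    case: eqP => // k3; rewrite coefXn; case: eqP => // ik.
    by move: i3; rewrite ik k3.
  by case: ltnP => // i2; case: ifP => // d; move: i3; lia.
(* Squaring X^3 c(X^5) gives X * X^5 c(X^5)^2, all of whose exponents are 1 mod 5. *)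
have -> : 'X * msect 5 3 (psi R K) ^+ 2
    = msect 5 1 ((\sum_(k < K | c3 k) 'X^(tri k)) ^+ 2).
  rewrite -psi3.
  have [] // := @msect5_expand _ 0 ('X * msect 5 3 (psi R K) ^+ 2) 0 0 0
    (('X^3 * (msect 5 3 (psi R K) \Po 'X^5)) ^+ 2).
  by ring: (comp_polyX ('X^5 : {poly R})).
rewrite coefD !coef_msect // psiT [in RHS]mulr_natl coefMn !coef2 -natrD -mulrnA.
congr (_%:R); rewrite pairs_tri; last lia.
by rewrite mulnC.
Qed.

Lemma psi_pow5 K : psi 'F_5 K ^+ 5 = psi 'F_5 K \Po 'X^5.
Proof.
have p5 : 5 \in [pchar {poly 'F_5}] by rewrite pchar_poly pchar_Fp.
rewrite -(pFrobenius_autE p5) /psi !raddf_sum; apply: eq_bigr => k _ /=.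
by rewrite pFrobenius_autE comp_Xn_poly -!exprM mulnC.
Qed.

Lemma msect_psi_pow4 N K : (5 * N <= K)%N ->
  eqmodX N (msect 5 2 (psi 'F_5 K ^+ 4)) (psi 'F_5 K ^+ 4).
Proof.
move=> NK; have := eqmodX_sqr_psi 'F_5 NK; rewrite msect_psi2 msect_psi4.
set a := msect 5 0 _; set b := msect 5 1 _; set c := msect 5 3 _ => h.
have five0 : (5%:R = 0 :> {poly 'F_5}).
  by rewrite -polyC_natr (pchar_Fp_0 (isT : prime 5)).
have mod5 (p q r : {poly 'F_5}) : p = q + 5%:R * r -> p = q.
  by move=> ->; rewrite five0 mul0r addr0.
have {h} h : eqmodX N (a * b + 'X * c ^+ 2) (psi 'F_5 K ^+ 2).
  (* The factor 3 is the inverse of 2 modulo 5. *)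
  have -> : a * b + 'X * c ^+ 2
      = 3%:R * (2%:R * a * b + 'X * c ^+ 2 + 'X * c ^+ 2).
    by apply/esym/(mod5 _ _ (a * b + 'X * c ^+ 2)); ring.
  have -> : psi 'F_5 K ^+ 2 = 3%:R * (2%:R * psi 'F_5 K ^+ 2).
    by apply/esym/(mod5 _ _ (psi 'F_5 K ^+ 2)); ring.
  exact: eqmodXM.
have -> : 6%:R * a ^+ 2 * b ^+ 2 + 12%:R * 'X * a * b * c ^+ 2 + 'X^2 * c ^+ 4
    = (a * b + 'X * c ^+ 2) ^+ 2.
  by apply: (mod5 _ _ (a ^+ 2 * b ^+ 2 + 2%:R * 'X * a * b * c ^+ 2)); ring.
by rewrite (exprM _ 2 2); apply: eqmodXX.
Qed.

Lemma psi_coef0 (R : comNzRingType) K : (0 < K)%N -> (psi R K)`_0 = 1.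
Proof.
by case: K => // K _; rewrite coef_psi big_ord_recl big1.
Qed.

Lemma pod_psi3 n : (-1) ^+ n * (pod (5 * n + 2))%:R
  = (psi 'F_5 (10 * n + 10) ^+ 3)`_n.
Proof.
(* [M] is large enough for precision 5(n+1), which covers exponent 5n + 2 and leaves precision n + 1
   after the section. *)
pose M := (5 * n + 5)%N; pose P := podgf 'F_5 (2 * M + 1) (2 * M).
pose S := psi 'F_5 (2 * M).
have PS : eqmodX (5 * n.+1) (P * (S \Po 'X^5)) (S ^+ 4).
  rewrite -psi_pow5 (exprS _ 4) mulrA -[X in eqmodX _ _ X]mul1r.
  by apply: eqmodXM => //; apply: (eqmodXW _ (podgf_psi _ _)); lia.
have PS2 : eqmodX n.+1 (S * msect 5 2 P) (S * S ^+ 3).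
  rewrite mulrC -msectM_comp // -exprS.
  apply: (etrans (eqmodX_msect (isT : 2 < 5)%N PS)).
  by apply: msect_psi_pow4; rewrite /M; lia.
have M0 : (0 < 2 * M)%N by rewrite /M; lia.
have /eqmodXP/(_ n (ltnSn n)) := eqmodXMI (psi_coef0 _ M0) PS2.
rewrite coef_msect // coef_poly ifT; last by rewrite /M; lia.
rewrite pod_countT; last by rewrite /M; lia.
(* 5n + 2 and n have the same parity. *)
rewrite -signr_odd oddD oddM addbF signr_odd => ->.
by congr ((psi _ _ ^+ 3)`_n); rewrite /M; lia.
Qed.

Theorem theorem3 (n : nat) :
  ((pod (5 * n + 2))%:Z
     = 2 * (-1) ^+ n * (nb_sum_of_squares 3 (8 * n + 3))%:Z %[mod 5])%Z.
Proof.
apply/eqP; rewrite eqz_mod_dvd (dvdz_pcharf (pchar_Fp (isT : prime 5))).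
rewrite rmorphB !rmorphM rmorphXn rmorphN1 /= subr_eq0 -!pmulrn.
rewrite (sum_three_squares _ (K := 10 * n + 10)); last lia.
rewrite -pod_psi3 !mulrA.
(* The signs cancel and 2 * 8 = 16 is 1 modulo 5. *)
have -> : 2%:R * (-1) ^+ n * 8%:R * (-1) ^+ n = 1 :> 'F_5.
  rewrite mulrAC -(mulrA 2%:R) -expr2 sqrr_sign mulr1 -natrM.
  exact: val_inj.
by rewrite mul1r.
Qed.
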